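(* Let $\mathcal{G}$ be any graph with vertices $v_1,\ldots,v_n$, and consider an integer vector $\mathbf{k}=(k_1,\ldots,k_n)\in\mathbb{N}^n$ (positive integers) such that $k_i$ is even for all $i$. Then the $\mathbf{k}$-blow-up $\mathcal{G}^{(\mathbf{k})}$ admits an adapted complex structure such that the corresponding basic subgraph is the union of copies of $\mathbb{A}_1$.
   Context: Graphs are finite and simple. The $\mathbf{k}$-blow-up $\mathcal{G}^{(\mathbf{k})}$ of $\mathcal{G}$ is the graph obtained by replacing every vertex $v_i$ of $\mathcal{G}$ with $k_i$ different vertices $v_i^{(1)},\ldots,v_i^{(k_i)}$, where $v_i^{(r)}$ is adjacent to $v_j^{(l)}$ if and only if $i\neq j$ and $v_i$ is adjacent to $v_j$ in $\mathcal{G}$. For a graph $\mathcal{H}=(V,E)$ label $V=\{u_1,\dots,u_N\}$ and write $e_{i,j}$ ($i<j$) for the edge joining $u_i$ and $u_j$, if it exists. The Lie algebra $\mathfrak{n}_{\mathcal{H}}$ is the real vector space with basis $V\cup E$ and Lie bracket $[u_i,u_j]=e_{i,j}$ for $i<j$ if $u_i,u_j$ are adjacent, $[u_i,u_j]=0$ if they are not adjacent, and all elements of $E$ central. A complex structure on a real Lie algebra $\mathfrak{g}$ is a linear map $J:\mathfrak{g}\to\mathfrak{g}$ with $J^2=-\mathrm{Id}$ and $[x,y]+J([Jx,y]+[x,Jy])-[Jx,Jy]=0$ for all $x,y\in\mathfrak{g}$. An adapted complex structure on the graph $\mathcal{H}$ is a complex structure $J$ on $\mathfrak{n}_{\mathcal{H}}$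 such that for every $x\in V\cup E$ either $Jx\in V\cup E$ or $-Jx\in V\cup E$. An edge is distinguished if it joins a pair of vertices $v,w$ with $w=Jv$. Corresponding basic subgraph of $(\mathcal{H},J)$: the spanning subgraph of $\mathcal{H}$ (same vertices) whose edges are exactly the distinguished edges. It is a $J$-invariant (up to sign) subgraph. $\mathbb{A}_1$ is the graph with two vertices and no edges, carrying the structure $J$ that maps one vertex to the other up to sign; thus the basic subgraph being a union of copies of $\mathbb{A}_1$ means that it has no edges and its vertices are partitioned into pairs $\{v,\pm Jv\}$. *)

(* Defs.v *)
From HB Require Import structures.
From mathcomp Require Import all_boot all_order all_algebra.
From mathcomp Require Import reals.

Set Implicit Arguments.
Unset Strict Implicit.
Unset Printing Implicit Defensive.

Import Order.TTheory GRing.Theory Num.Theory.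
Local Open Scope ring_scope.

Record sgraph (V : finType) := SGraph {
  adj : rel V;
  adj_sym : symmetric adj;
  adj_irrefl : irreflexive adj }.

Section Blowup.
Variables (n : nat) (G : sgraph 'I_n) (k : 'I_n -> nat).

(* The vertex v_i^(r+1) is Tagged (fun i => 'I_(k i)) r, with tag i. *)
Definition blowup_vertex : finType := {i : 'I_n & 'I_(k i)}.

Definition blowup_adj : rel blowup_vertex :=
  fun x y => (tag x != tag y) && adj G (tag x) (tag y).

Lemma blowup_adj_sym : symmetric blowup_adj.
Proof. by move=> x y; rewrite /blowup_adj eq_sym adj_sym. Qed.

Lemma blowup_adj_irrefl : irreflexive blowup_adj.
Proof. by move=> x; rewrite /blowup_adj eqxx. Qed.

Definition blowup : sgraph blowup_vertex :=
  SGraph blowup_adj_sym blowup_adj_irrefl.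

End Blowup.

Record lieAlgebra (R : realType) := LieAlgebra {
  lie_sort :> lmodType R;
  bracket : lie_sort -> lie_sort -> lie_sort;
  bracket_linl : forall z, linear (bracket^~ z);
  bracket_linr : forall z, linear (bracket z);
  bracketxx : forall x, bracket x x = 0;
  jacobi : forall x y z,
    bracket x (bracket y z) + bracket y (bracket z x)
      + bracket z (bracket x y) = 0 }.

Definition complex_structure (R : realType) (g : lieAlgebra R)
    (J : {linear g -> g}) : Prop :=
  (forall x : g, J (J x) = - x) /\
  (forall x y : g,
     bracket x y + J (bracket (J x) y + bracket x (J y))
       - bracket (J x) (J y) = 0).

Section GraphLieAlgebra.
Variables (R : realType) (V : finType) (H : sgraph V).
(* The numbering of the vertices: lab u_i = i, counting from 0. It is not
   required to be injective here. *)
Variable lab : V -> 'I_#|V|.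

(* Each edge of H occurs exactly once, as the pair (u_i, u_j) with i < j. *)
Definition edge : finType :=
  {e : V * V | adj H e.1 e.2 && (lab e.1 < lab e.2)%N}.

Definition basis_index : finType := (V + edge)%type.

Definition n_space : lmodType R := {ffun basis_index -> R^o}.

Definition bvec (b : basis_index) : n_space :=
  ([ffun c => (c == b)%:R] : {ffun basis_index -> R^o}).

Definition vvec (v : V) : n_space := bvec (inl v).

Definition evec (e : edge) : n_space := bvec (inr e).

(* The bilinear alternating extension of the bracket on basis vectors, given
   by its coordinates; see n_bracket_edge, n_bracket_nonadj,
   n_bracket_centrall and n_bracket_centralr. *)
Definition n_bracket (x y : n_space) : n_space :=
  let c (z : n_space) (v : V) : R := (z : {ffun basis_index -> R^o}) (inl v) in
  ([ffun b => match b with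
     | inl _ => 0
     | inr e => c x (val e).1 * c y (val e).2 - c x (val e).2 * c y (val e).1
     end] : {ffun basis_index -> R^o}).

Lemma n_bracket_linl z : linear (n_bracket^~ z).
Proof.
move=> a x y; apply/ffunP => -[v|e]; rewrite !ffunE /=.
  by rewrite scaler0 addr0.
by rewrite /GRing.scale /= !mulrDl mulrBr -!mulrA opprD addrACA.
Qed.

Lemma n_bracketxx x : n_bracket x x = 0.
Proof.
by apply/ffunP => -[v|e]; rewrite !ffunE //= mulrC subrr.
Qed.

Lemma n_bracketC x y : n_bracket x y = - n_bracket y x.
Proof.
apply/ffunP => -[v|e]; rewrite !ffunE /= ?oppr0 // opprB.
by rewrite mulrC; congr (_ - _); rewrite mulrC.
Qed.

Lemma n_bracket_linr z : linear (n_bracket z).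
Proof.
move=> a x y; rewrite n_bracketC n_bracket_linl opprD -scalerN.
by rewrite -!(n_bracketC z).
Qed.

Lemma n_bracket2 x y z : n_bracket x (n_bracket y z) = 0.
Proof. by apply/ffunP => -[v|e]; rewrite !ffunE //= !mulr0 subrr. Qed.

Lemma n_jacobi x y z :
  n_bracket x (n_bracket y z) + n_bracket y (n_bracket z x)
    + n_bracket z (n_bracket x y) = 0.
Proof. by rewrite !n_bracket2 !addr0. Qed.

Definition n_lie : lieAlgebra R :=
  LieAlgebra n_bracket_linl n_bracket_linr n_bracketxx n_jacobi.

Lemma n_bracket_edge (e : edge) :
  n_bracket (vvec (val e).1) (vvec (val e).2) = evec e.
Proof.
have lt_lab (f : edge) : (lab (val f).1 < lab (val f).2)%N.
  by case/andP: (valP f).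
have inlE (a b : V) : ((inl a : basis_index) == inl b) = (a == b).
  by apply/eqP/eqP => [[]|->].
have inrE (f f' : edge) : ((inr f : basis_index) == inr f') = (f == f').
  by apply/eqP/eqP => [[]|->].
apply/ffunP => -[v|f]; rewrite !ffunE //= !inlE inrE.
rewrite -!natrM !mulnb.
have -> : ((val f).2 == (val e).1) && ((val f).1 == (val e).2) = false.
  apply/negP => /andP[/eqP E1 /eqP E2]; have := lt_lab f.
  by rewrite E1 E2 ltnNge ltnW // lt_lab.
by rewrite subr0 -(inj_eq val_inj) -pair_eqE.
Qed.

Lemma n_bracket_nonadj (u v : V) :
  ~~ adj H u v -> n_bracket (vvec u) (vvec v) = 0.
Proof.
move=> nuv.
have inlE (a b : V) : ((inl a : basis_index) == inl b) = (a == b).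
  by apply/eqP/eqP => [[]|->].
apply/ffunP => -[w|f]; rewrite !ffunE //= !inlE -!natrM !mulnb.
have /andP[af _] := valP f.
case: andP => [[/eqP E1 /eqP E2]|_]; first by move: af nuv; rewrite E1 E2 => ->.
case: andP => [[/eqP E1 /eqP E2]|_]; last by rewrite subr0.
by move: af nuv; rewrite E1 E2 adj_sym => ->.
Qed.

Lemma n_bracket_centrall (e : edge) (x : n_space) : n_bracket (evec e) x = 0.
Proof. by apply/ffunP => -[v|f]; rewrite !ffunE //= !mul0r subrr. Qed.

Lemma n_bracket_centralr (e : edge) (x : n_space) : n_bracket x (evec e) = 0.
Proof. by rewrite n_bracketC n_bracket_centrall oppr0. Qed.

Variable J : {linear n_lie -> n_lie}.

Definition adapted_complex_structure : Prop :=
  complex_structure J /\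
  (forall b : basis_index, exists c : basis_index,
     J (bvec b) = bvec c \/ - J (bvec b) = bvec c).

(* An edge is an unordered pair, so w = J v is tested in both orders. *)
Definition distinguished : rel V :=
  fun v w =>
    adj H v w && ((vvec w == J (vvec v)) || (vvec v == J (vvec w))).

Lemma distinguished_sym : symmetric distinguished.
Proof. by move=> v w; rewrite /distinguished adj_sym orbC. Qed.

Lemma distinguished_irrefl : irreflexive distinguished.
Proof. by move=> v; rewrite /distinguished adj_irrefl. Qed.

Definition basic_subgraph : sgraph V :=
  SGraph distinguished_sym distinguished_irrefl.

(* The edgeless graph B on the vertices of H, with its vertices partitioned
   into pairs {v, +Jv} or {v, -Jv}, each being a copy of A_1. *)
Definition union_of_A1 (B : sgraph V) : Prop :=
  (forall v w : V, ~~ adj B v w) /\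
  (exists P : {set {set V}}, partition P [set: V] /\
     (forall A : {set V}, A \in P -> exists v w : V,
        [/\ v != w, A = [set v; w] &
            J (vvec v) = vvec w \/ - J (vvec v) = vvec w])).

End GraphLieAlgebra.

(* Main.v *)
(** Pair the copies of each vertex of [G] by a fixed-point-free involution [s],
    and let [J] send one vertex of each pair to the other and the latter to
    minus the former. Adjacent vertices lie over distinct vertices of [G], so
    every edge has a lower end [u] and an upper end [w], and [J [u, w] = [J u, w]]
    is well defined. For such [u] and [w] the Nijenhuis expression collapses to
    [[u, w] + [J (J u), w] + [J u, J w] - [J u, J w] = 0]. No edge joins a
    vertex to its partner, so no edge is distinguished. *)

Require Import Defs.
From HB Require Import structures.
From mathcomp Require Import all_boot all_order all_algebra.
From mathcomp Require Import reals ring.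

Import GRing.Theory.

Local Open Scope ring_scope.

(** * Signed edge coordinates on the graph Lie algebra *)

Section EdgeCoordinates.
Context {R : realType} {V : finType} {H : sgraph V} {lab : V -> 'I_#|V|}.
Hypothesis lab_inj : injective lab.

Local Notation space := (n_space R H lab).

Definition coord (z : space) (b : basis_index H lab) : R :=
  (z : {ffun basis_index H lab -> R^o}) b.

(* The coefficient of [[u, w]] in [z], with sign according to the orientation
   of the pair; it is [0] when [u] and [w] are not adjacent. *)
Definition ecoord (z : space) (u w : V) : R :=
  if insub (u, w) is Some e then coord z (inr e)
  else if insub (w, u) is Some e then - coord z (inr e) else 0.

Lemma coordD y z b : coord (y + z) b = coord y b + coord z b.
Proof. by rewrite /coord ffunE. Qed.

Lemma coordN z b : coord (- z) b = - coord z b.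
Proof. by rewrite /coord ffunE. Qed.

Lemma coordZ a z b : coord (a *: z) b = a * coord z b.
Proof. by rewrite /coord ffunE. Qed.

Lemma coord_bracket_vertex (x y : space) v : coord (n_bracket x y) (inl v) = 0.
Proof. by rewrite /coord ffunE. Qed.

Lemma coord_vvec v v' : coord (vvec R H lab v) (inl v') = (v' == v)%:R.
Proof.
by rewrite /coord ffunE.
Qed.

Lemma ecoord_edge (z : space) (e : edge H lab) :
  ecoord z (val e).1 (val e).2 = coord z (inr e).
Proof. by rewrite /ecoord -surjective_pairing valK. Qed.

Lemma ecoordC (z : space) u w : ecoord z u w = - ecoord z w u.
Proof.
rewrite /ecoord; case: insubP => [e /andP[_ /= lt_uw] _|_].
  by rewrite insubN ?opprK //= ltnNge ltnW ?andbF.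
by case: insubP; rewrite ?oppr0.
Qed.

Lemma ecoordD y z u w : ecoord (y + z) u w = ecoord y u w + ecoord z u w.
Proof.
rewrite /ecoord; case: insub => [e|]; first exact: coordD.
by case: insub => [e|]; rewrite ?coordD ?opprD ?addr0.
Qed.

Lemma ecoordZ a z u w : ecoord (a *: z) u w = a * ecoord z u w.
Proof.
rewrite /ecoord; case: insub => [e|]; first exact: coordZ.
by case: insub => [e|]; rewrite ?coordZ ?mulrN ?mulr0.
Qed.

Lemma ecoordN z u w : ecoord (- z) u w = - ecoord z u w.
Proof. by rewrite -scaleN1r ecoordZ mulN1r. Qed.

Lemma ecoord_vvec v u w : ecoord (vvec R H lab v) u w = 0.
Proof.
rewrite /ecoord /coord; case: insub => [e|]; first by rewrite ffunE.
by case: insub => [e|//]; rewrite ffunE oppr0.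
Qed.

Lemma edge_between u w : adj H u w ->
  exists e : edge H lab, val e = (u, w) \/ val e = (w, u).
Proof.
move=> uw; case: (ltngtP (lab u) (lab w)) => [lt|lt|/val_inj/lab_inj eq_uw].
- have e_uw : adj H (u, w).1 (u, w).2 && (lab (u, w).1 < lab (u, w).2)%N.
    by rewrite /= uw.
  by exists (Sub (u, w) e_uw); left.
- have e_wu : adj H (w, u).1 (w, u).2 && (lab (w, u).1 < lab (w, u).2)%N.
    by rewrite /= adj_sym uw.
  by exists (Sub (w, u) e_wu); right.
- by move: uw; rewrite eq_uw adj_irrefl.
Qed.

(** Swapping the ends changes the sign of both sides, so the formula no longer depends on how [lab]
    orients the edge. *)
Lemma ecoord_bracket (x y : space) u w : adj H u w ->
  ecoord (n_bracket x y) u w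
  = coord x (inl u) * coord y (inl w) - coord x (inl w) * coord y (inl u).
Proof.
move=> /edge_between [e [] eE].
  by have := ecoord_edge (n_bracket x y) e; rewrite eE /= => ->;
    rewrite /coord ffunE eE.
rewrite ecoordC; have := ecoord_edge (n_bracket x y) e; rewrite eE /= => ->.
by rewrite /coord ffunE eE /=; ring.
Qed.

Lemma vvec_bracket_edge u w : adj H u w ->
  exists e : edge H lab,
    n_bracket (vvec R H lab u) (vvec R H lab w) = evec R e \/
    - n_bracket (vvec R H lab u) (vvec R H lab w) = evec R e.
Proof.
move=> /edge_between [e eE]; exists e; rewrite -n_bracket_edge.
by case: eE => ->; [left|right; rewrite /= -n_bracketC].
Qed.

Lemma vvec_inj : injective (vvec R H lab).
Proof.
move=> u v /(congr1 (fun z => coord z (inl u))); rewrite !coord_vvec eqxx.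
by case: eqP => // _ /eqP; rewrite oner_eq0.
Qed.

(** At [u] the coordinates would give $1 + [u = v] = 0$, impossible in characteristic 0. *)
Lemma vvec_neqN u v : vvec R H lab u <> - vvec R H lab v.
Proof.
move=> /(congr1 (fun z => coord z (inl u))).
rewrite coordN !coord_vvec eqxx => /eqP; rewrite -subr_eq0 opprK -natrD.
by rewrite Num.Theory.pnatr_eq0.
Qed.

(** * The complex structure of a vertex pairing [s] with signs from [p] and levels [t] *)

Section PairedStructure.
Variables (s : V -> V) (p : pred V) (t : V -> nat).
Hypothesis sK : involutive s.
Hypothesis ps : forall v, p (s v) = ~~ p v.
Hypothesis ts : forall v, t (s v) = t v.
Hypothesis adjs : forall u w, adj H (s u) w = adj H u w.
Hypothesis adjt : forall u w, adj H u w -> t u != t w.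

Let sg v : R := (-1) ^+ p v.

Let sgs v : sg (s v) = - sg v.
Proof. by rewrite /sg ps; case: (p v); rewrite ?opprK. Qed.

Let sg2 v : sg v * sg v = 1.
Proof. by rewrite /sg -signr_addb addbb. Qed.

(** In coordinates, this is $v \mapsto sg(v)\, s(v)$ on vertices and $[u,w] \mapsto sg(u)\,[s(u),w]$
    on edges with $t(u) < t(w)$. Reading off a coefficient goes back along [s], whence the sign
    $sg(s(v)) = -sg(v)$. The two edge branches occur because [lab], which orients the stored pair,
    is unrelated to [t]. *)
Definition paired_fun (z : space) : space :=
  ([ffun b => match b with
     | inl v => - sg v * coord z (inl (s v))
     | inr e => let: (u, w) := val e in
         if (t u < t w)%N then - sg u * ecoord z (s u) w
         else - sg w * ecoord z u (s w)
     end] : {ffun basis_index H lab -> R^o}).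

Lemma paired_fun_linear : linear paired_fun.
Proof.
move=> a y z; apply/ffunP => -[v|e].
  by rewrite !ffunE /= coordD coordZ /GRing.scale /=; ring.
rewrite !ffunE /=; case: (val e) => u w; rewrite !ecoordD !ecoordZ.
by rewrite /GRing.scale /=; case: ifP => _; ring.
Qed.

HB.instance Definition _ :=
  GRing.isLinear.Build R space space *:%R paired_fun paired_fun_linear.

Definition paired_J : {linear n_lie R H lab -> n_lie R H lab} :=
  (paired_fun : {linear space -> space}).

Lemma coord_paired z v : coord (paired_J z) (inl v) = - sg v * coord z (inl (s v)).
Proof. by rewrite /coord ffunE. Qed.

Lemma ecoord_paired z u w : adj H u w -> (t u < t w)%N ->
  ecoord (paired_J z) u w = - sg u * ecoord z (s u) w.
Proof.
move=> /edge_between [e [] eE] lt_uw.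
  have := ecoord_edge (paired_J z) e; rewrite eE /= => ->.
  by rewrite /coord ffunE eE lt_uw.
rewrite ecoordC; have := ecoord_edge (paired_J z) e; rewrite eE /= => ->.
by rewrite /coord ffunE eE ltnNge ltnW //= (ecoordC _ w); ring.
Qed.

(** By [adjt] every edge has a strictly lower end, and [ecoord] is antisymmetric, so testing edges
    upwards along [t] suffices. *)
Lemma n_space_ext (y z : space) :
    (forall v, coord y (inl v) = coord z (inl v)) ->
    (forall u w, adj H u w -> (t u < t w)%N -> ecoord y u w = ecoord z u w) ->
  y = z.
Proof.
move=> eqv eqe; apply/ffunP => -[v|e]; first exact: eqv.
have /andP[uw _] := valP e.
rewrite -[LHS]ecoord_edge -[RHS]ecoord_edge.
case: (ltngtP (t (val e).1) (t (val e).2)) (adjt _ _ uw) => // lt _.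
  exact: eqe.
by rewrite ecoordC [RHS]ecoordC eqe // adj_sym.
Qed.

Lemma paired_vvec v : paired_J (vvec R H lab v) = sg v *: vvec R H lab (s v).
Proof.
apply: n_space_ext => [w|u w uw lt].
  rewrite coord_paired coordZ !coord_vvec (inv_eq sK).
  by case: eqP => [->|_]; rewrite ?sgs ?opprK ?mulr0.
by rewrite ecoord_paired // ecoordZ !ecoord_vvec !mulr0.
Qed.

Lemma paired_vvec_sign v :
  paired_J (vvec R H lab v) = vvec R H lab (s v) \/
  - paired_J (vvec R H lab v) = vvec R H lab (s v).
Proof.
rewrite paired_vvec /sg; case: (p v); last by left; rewrite scale1r.
by right; rewrite scaleN1r opprK.
Qed.

(** Used for adaptedness: if [u] and [w] are adjacent then so are [s u] and [w], and the right side
    is a basis edge up to sign. *)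
Lemma paired_bracket u w : (t u < t w)%N ->
  paired_J (n_bracket (vvec R H lab u) (vvec R H lab w))
  = sg u *: n_bracket (vvec R H lab (s u)) (vvec R H lab w).
Proof.
move=> lt_uw; apply: n_space_ext => [v|a b ab lt_ab].
  by rewrite coord_paired coordZ !coord_bracket_vertex !mulr0.
rewrite ecoord_paired // ecoordZ !ecoord_bracket ?adjs // !coord_vvec.
(* The mixed terms vanish: they would force [t u < t w = t a < t b = t u]. *)
have -> : (b == u)%:R * (s a == w)%:R = 0 :> R.
  rewrite -natrM mulnb; case: eqP => //= bu; case: eqP => // aw.
  by move: lt_uw; rewrite -aw ts -bu ltnNge ltnW.
have -> : (b == s u)%:R * (a == w)%:R = 0 :> R.
  rewrite -natrM mulnb; case: eqP => //= bu; case: eqP => // aw.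
  by move: lt_uw; rewrite -aw -(ts u) -bu ltnNge ltnW.
by rewrite (inv_eq sK); case: eqP => [->|_]; rewrite ?sgs ?opprK // !mul0r subr0 !mulr0.
Qed.

Lemma paired_complex : complex_structure paired_J.
Proof.
split=> [x|x y].
  apply: n_space_ext => [v|u w uw lt].
    rewrite !coord_paired sK sgs coordN.
    by rewrite -[in RHS](mul1r (coord _ _)) -(sg2 v); ring.
  (* By [ts], [s u] is again the lower end, so the same rule applies twice. *)
  rewrite !ecoord_paired ?adjs ?ts // sK sgs ecoordN.
  by rewrite -[in RHS](mul1r (ecoord _ _ _)) -(sg2 u); ring.
apply/eqP; rewrite subr_eq0; apply/eqP.
apply: n_space_ext => [v|u w uw lt].
  rewrite coordD coord_paired coordD !coord_bracket_vertex.
  by rewrite addr0 mulr0 addr0.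
rewrite ecoordD ecoord_paired // ecoordD.
rewrite !ecoord_bracket ?adjs // !coord_paired !sK !sgs.
(* Inserting $sg(u)^2 = 1$ lets [ring] cancel the terms of $[x,y]$; the remaining ones, with factor
   $sg(u)\,sg(w)$, form $[Jx,Jy]$. *)
rewrite -[coord x (inl u) * _](mul1r) -[coord x (inl w) * _]mul1r -(sg2 u).
ring.
Qed.

Lemma paired_adapted : adapted_complex_structure paired_J.
Proof.
split; first exact: paired_complex.
have signed_edge u w : (t u < t w)%N -> adj H u w ->
    exists c, paired_J (n_bracket (vvec R H lab u) (vvec R H lab w)) = bvec R c \/
      - paired_J (n_bracket (vvec R H lab u) (vvec R H lab w)) = bvec R c.
  move=> lt_uw uw; rewrite paired_bracket //.
  have [c cE] : exists e : edge H lab,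
      n_bracket (vvec R H lab (s u)) (vvec R H lab w) = evec R e \/
      - n_bracket (vvec R H lab (s u)) (vvec R H lab w) = evec R e.
    by apply: vvec_bracket_edge; rewrite adjs.
  exists (inr c); rewrite /sg; case: (p u); rewrite ?scaleN1r ?scale1r ?opprK //.
  by case: cE; [right|left].
case=> [v|e]; first by exists (inl (s v)); exact: paired_vvec_sign.
have /andP[uw _] := valP e.
have eE := n_bracket_edge R e; rewrite /evec in eE.
case: (ltngtP (t (val e).1) (t (val e).2)) (adjt _ _ uw) => // lt _.
  by rewrite -eE; exact: signed_edge.
(* The lower end is stored second: reversing the bracket exchanges the two sign cases. *)
rewrite -eE n_bracketC raddfN opprK.
have [|c []] := signed_edge _ _ lt; first by rewrite adj_sym.
  by exists c; right.
by exists c; left.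
Qed.

Lemma paired_partner v w :
  vvec R H lab w = paired_J (vvec R H lab v) -> w = s v.
Proof.
case: (paired_vvec_sign v) => [-> /vvec_inj //|JE].
by rewrite -[paired_J _]opprK JE => /vvec_neqN.
Qed.

Lemma paired_union_of_A1 : union_of_A1 paired_J (basic_subgraph paired_J).
Proof.
split=> [v w|].
  (* A distinguished edge would join partners, which have equal level by [ts], against [adjt]. *)
  apply/negP => /andP[vw /orP[]/eqP/paired_partner vwE];
    by move: (adjt _ _ vw); rewrite vwE ts eqxx.
exists (equivalence_partition (fun v w => (w == v) || (w == s v)) [set: V]).
split.
  apply/equivalence_partitionP => u v w _ _ _; rewrite eqxx; split=> //.
  by case/orP => /eqP ->; rewrite ?sK // orbC.
move=> A /imsetP[v _ ->]; exists v, (s v); split.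
- by apply/eqP => /(congr1 p); rewrite ps; case: (p v).
- by apply/setP => w; rewrite !inE.
- exact: paired_vvec_sign.
Qed.

End PairedStructure.
End EdgeCoordinates.

(** * Pairing the copies in an even blow-up: $2j \leftrightarrow 2j+1$ *)

Definition flip (r : nat) : nat := if odd r then r.-1 else r.+1.

Lemma flipK : involutive flip.
Proof.
move=> r; rewrite /flip; case r_odd: (odd r); last by rewrite /= r_odd.
by case: r r_odd => //= r /negbTE ->.
Qed.

Lemma odd_flip r : odd (flip r) = ~~ odd r.
Proof.
rewrite /flip; case r_odd: (odd r); last by rewrite /= r_odd.
by case: r r_odd => //= r /negbTE.
Qed.

(** Only an even $r = m-1$ could leave the range, and then $m$ would be odd. *)
Lemma flip_ltn m r : ~~ odd m -> (r < m)%N -> (flip r < m)%N.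
Proof.
move=> m_even lt_rm; rewrite /flip; case: ifP => r_odd.
  exact: leq_ltn_trans (leq_pred r) lt_rm.
rewrite ltn_neqAle lt_rm andbT; apply: contraNneq m_even => <-.
by rewrite /= r_odd.
Qed.

Theorem proposition6p16 (R : realType) (n : nat) (G : sgraph 'I_n)
    (k : 'I_n -> nat) (k_gt0 : forall i : 'I_n, (0 < k i)%N)
    (k_even : forall i : 'I_n, ~~ odd (k i))
    (lab : blowup_vertex k -> 'I_#|blowup_vertex k|)
    (lab_inj : injective lab) :
  exists J : {linear n_lie R (blowup G k) lab -> n_lie R (blowup G k) lab},
    adapted_complex_structure J /\ union_of_A1 J (basic_subgraph J).
Proof.
pose s (v : blowup_vertex k) : blowup_vertex k :=
  Tagged (fun i => 'I_(k i))
    (Ordinal (flip_ltn _ _ (k_even (tag v)) (ltn_ord (tagged v)))).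
pose p (v : blowup_vertex k) := odd (tagged v).
pose t (v : blowup_vertex k) : nat := tag v.
have sK : involutive s.
  by case=> i r; congr Tagged; apply/val_inj; rewrite /= flipK.
have ps v : p (s v) = ~~ p v by exact: odd_flip.
have ts v : t (s v) = t v by [].
(* Blow-up adjacency sees only the tags, and [s] preserves them. *)
have adjs u w : adj (blowup G k) (s u) w = adj (blowup G k) u w by [].
have adjt u w : adj (blowup G k) u w -> t u != t w by case/andP.
exists (paired_J s p t); split.
  exact: paired_adapted.
exact: paired_union_of_A1.
Qed.
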